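(* The bicyclic monoid $\mathcal{B}=\langle a,b\mid ab=1\rangle$ satisfies the semigroup identity $$xy^2x\; xy\; xy^2x \;=\; xy^2x\; yx\; xy^2x ,$$ i.e. this equality holds for all $x,y\in\mathcal{B}$.
   Context: The bicyclic monoid $\mathcal{B}$ is the monoid generated by two elements $a,b$ subject to the single relation $ab=1$, where $1$ is the identity element. *)

(* Defs.v *)
From HB Require Import structures.
From mathcomp Require Import all_boot.
From mathcomp Require Import boolp.

Set Implicit Arguments.
Unset Strict Implicit.
Unset Printing Implicit Defensive.

Local Open Scope quotient_scope.

(* The congruence on the free monoid [seq A] generated by the pairs in [rels]. *)
Inductive pres_cong (A : eqType) (rels : seq (seq A * seq A)) :
    seq A -> seq A -> Prop :=
| PresRel u v r : r \in rels -> pres_cong rels (u ++ r.1 ++ v) (u ++ r.2 ++ v)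
| PresRefl s : pres_cong rels s s
| PresSym s t : pres_cong rels s t -> pres_cong rels t s
| PresTrans s t w :
    pres_cong rels s t -> pres_cong rels t w -> pres_cong rels s w.

Lemma pres_cong_cat (A : eqType) (rels : seq (seq A * seq A)) s s' t t' :
  pres_cong rels s s' -> pres_cong rels t t' ->
  pres_cong rels (s ++ t) (s' ++ t').
Proof.
move=> Hs Ht; apply: (@PresTrans _ _ _ (s' ++ t)).
  elim: Hs => [u v r Hr|w|w w' _|w w' w'' _ IH1 _] /=.
  - by rewrite -!catA; exact: PresRel.
  - exact: PresRefl.
  - exact: PresSym.
  - exact: PresTrans.
elim: Ht => [u v r Hr|w|w w' _|w w' w'' _ IH1 _] /=.
- by rewrite !(catA s'); exact: PresRel.
- exact: PresRefl.
- exact: PresSym.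
- exact: PresTrans.
Qed.

Definition pres_congb (A : eqType) (rels : seq (seq A * seq A)) : rel (seq A) :=
  fun s t => `[< pres_cong rels s t >].

Lemma pres_congb_refl (A : eqType) (rels : seq (seq A * seq A)) :
  reflexive (pres_congb rels).
Proof. by move=> s; apply/asboolP; exact: PresRefl. Qed.

Lemma pres_congb_sym (A : eqType) (rels : seq (seq A * seq A)) :
  symmetric (pres_congb rels).
Proof. by move=> s t; apply/asboolP/asboolP; exact: PresSym. Qed.

Lemma pres_congb_trans (A : eqType) (rels : seq (seq A * seq A)) :
  transitive (pres_congb rels).
Proof.
move=> t s w /asboolP Hst /asboolP Htw; apply/asboolP.
exact: PresTrans Hst Htw.
Qed.

Canonical pres_equiv (A : eqType) (rels : seq (seq A * seq A)) :=
  EquivRel (pres_congb rels) (pres_congb_refl rels) (pres_congb_sym rels)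
    (@pres_congb_trans A rels).

(* The monoid presented by the generators [A] and the relations r.1 = r.2 for
   r in [rels]. *)
Definition presented (A : choiceType) (rels : seq (seq A * seq A)) : Type :=
  {eq_quot pres_equiv rels}.

HB.instance Definition _ (A : choiceType) (rels : seq (seq A * seq A)) :=
  Choice.on (presented rels).
HB.instance Definition _ (A : choiceType) (rels : seq (seq A * seq A)) :=
  Quotient.on (presented rels).

Definition word_class (A : choiceType) (rels : seq (seq A * seq A))
  (s : seq A) : presented rels := \pi_(presented rels) s.

Lemma word_classP (A : choiceType) (rels : seq (seq A * seq A)) s t :
  word_class rels s = word_class rels t <-> pres_cong rels s t.
Proof.
split=> [/eqmodP/asboolP //|H].
by apply/eqmodP; apply/asboolP.
Qed.

Lemma word_class_repr (A : choiceType) (rels : seq (seq A * seq A))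
  (x : presented rels) : word_class rels (repr x) = x.
Proof. exact: reprK. Qed.

Definition pres_mul (A : choiceType) (rels : seq (seq A * seq A))
  (x y : presented rels) : presented rels :=
  word_class rels (repr x ++ repr y).

Lemma pres_mulE (A : choiceType) (rels : seq (seq A * seq A)) s t :
  pres_mul (word_class rels s) (word_class rels t) = word_class rels (s ++ t).
Proof.
by apply/word_classP; apply: pres_cong_cat; apply/word_classP;
   exact: word_class_repr.
Qed.

Lemma pres_mulA (A : choiceType) (rels : seq (seq A * seq A)) :
  associative (@pres_mul A rels).
Proof.
move=> x y z; rewrite -(word_class_repr x) -(word_class_repr y).
by rewrite -(word_class_repr z) !pres_mulE catA.
Qed.

Lemma pres_mul1 (A : choiceType) (rels : seq (seq A * seq A)) :
  left_id (word_class rels [::]) (@pres_mul A rels).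
Proof. by move=> x; rewrite -(word_class_repr x) pres_mulE. Qed.

Lemma pres_mulr1 (A : choiceType) (rels : seq (seq A * seq A)) :
  right_id (word_class rels [::]) (@pres_mul A rels).
Proof. by move=> x; rewrite -(word_class_repr x) pres_mulE cats0. Qed.

HB.instance Definition _ (A : choiceType) (rels : seq (seq A * seq A)) :=
  isMonoid.Build (presented rels) (@pres_mulA A rels) (@pres_mul1 A rels)
    (@pres_mulr1 A rels).

(* The letters are encoded as booleans: a is [true] and b is [false]. *)
Definition bicyclic : monoidType :=
  presented [:: ([:: true; false], [::] : seq bool)].

(* Main.v *)
Require Import Defs.
From mathcomp Require Import all_boot.
From mathcomp Require Import order ssralg ssrnum ssrint zify.

(** The relation [ab = 1] lets every element be written [b^i a^j], and the
    product of two such normal forms is again one, with explicit exponents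
    ([bnfM]).  Read a word as a walk on the integers in which [a] is a step up
    and [b] a step down: for the normal form with exponents [(i, j)], [i] is the
    depth (how far the walk goes below its starting point) and [j - i] is the
    rise (its total displacement).  These two numbers determine the element
    ([depth_rise_inj]).  The rise is additive, and a walk [p q] started at
    height [h] stays nonnegative iff [p] does from [h] and [q] does from
    [h + rise p] ([depthM]).

    The two sides of the identity have the same rise, since they have the same
    letters.  For their depths, let [x] and [y] have rises [r] and [s].  From
    height [h], the copies of [x] outside the middle factor start, on both
    sides, at the heights
      [h], [h + r + 2s], [h + 3r + 3s], [h + 4r + 5s],
    and the copies of [y] at
      [h + r], [h + r + s], [h + 4r + 3s], [h + 4r + 4s].
    The middle factor [xy] adds an [x] at [h + 2r + 2s], which lies between [h]
    and [h + 3r + 3s], and a [y] at [h + 3r + 2s], which lies between [h + r]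
    and [h + 4r + 3s]; the middle factor [yx] adds a [y] at [h + 2r + 2s],
    between [h + r + s] and [h + 4r + 4s], and an [x] at [h + 2r + 3s], between
    [h + r + 2s] and [h + 4r + 5s].  As a letter may be read at any height at
    or above its depth, the middle factor imposes no new condition on [h] in
    either order, so the depths agree. *)

Set Implicit Arguments.
Unset Strict Implicit.
Unset Printing Implicit Defensive.

Local Open Scope group_scope.

Definition bnf (p : nat * nat) : bicyclic :=
  word_class _ (nseq p.1 false ++ nseq p.2 true).

Definition bmul (p q : nat * nat) : nat * nat :=
  (p.1 + (q.1 - p.2), q.2 + (p.2 - q.1))%N.

Definition rise (p : nat * nat) : int := (p.2%:Z - p.1%:Z)%R.

(** Cancelling the innermost [ab] repeatedly leaves whichever of [a^j], [b^k]
    is longer. *)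
Lemma word_class_cancel (u v : seq bool) (j k : nat) :
  word_class _ (u ++ nseq j true ++ nseq k false ++ v)
  = word_class _ (u ++ nseq (k - j) false ++ nseq (j - k) true ++ v)
  :> bicyclic.
Proof.
elim: j k => [|j IHj] [|k] //=.
rewrite subSS -IHj; apply/word_classP.
have -> : true :: nseq j true ++ false :: nseq k false ++ v
          = nseq j true ++ [:: true; false] ++ nseq k false ++ v.
  by elim: j {IHj} => //= j ->.
rewrite !(catA u).
exact: (PresRel (u ++ nseq j true) (nseq k false ++ v) (mem_head _ _)).
Qed.

Lemma bnfM p q : bnf p * bnf q = bnf (bmul p q).
Proof.
case: p q => [i j] [k l]; rewrite [LHS]pres_mulE -catA.
rewrite word_class_cancel /bnf /bmul /=; congr (word_class _ _).
by rewrite catA -!nseqD [(l + _)%N]addnC.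
Qed.

Lemma bnf_surj (x : bicyclic) : exists p, x = bnf p.
Proof.
rewrite -(word_class_repr x); elim: (repr x) => [|c s [p IHs]].
  by exists (0, 0)%N.
have -> : word_class _ (c :: s) = word_class _ [:: c] * word_class _ s :> bicyclic.
  by rewrite [RHS]pres_mulE.
exists (bmul (if c then (0, 1) else (1, 0))%N p).
by rewrite IHs -bnfM; case: c.
Qed.

Lemma riseM p q : rise (bmul p q) = (rise p + rise q)%R.
Proof. by rewrite /rise /bmul /=; lia. Qed.

(** The depth of a product, as a condition on the starting height [h]: this form
    avoids maxima, so iterating it yields a conjunction of linear conditions,
    one for each letter. *)
Lemma depthM p q (h : int) :
  ((bmul p q).1%:Z <= h)%R = (p.1%:Z <= h)%R && (q.1%:Z <= h + rise p)%R.
Proof. by rewrite /rise /bmul /=; lia. Qed.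

Lemma depth_rise_inj p q :
  (forall h : int, (p.1%:Z <= h)%R = (q.1%:Z <= h)%R) -> rise p = rise q ->
  p = q.
Proof.
case: p q => [i j] [k l]; rewrite /rise /= => depth_eq rise_eq.
have := depth_eq i; have := depth_eq k => le_ik le_ki.
by congr pair; lia.
Qed.

Theorem corollary4p5 (x y : bicyclic) :
  x * y ^+ 2 * x * (x * y) * (x * y ^+ 2 * x)
  = x * y ^+ 2 * x * (y * x) * (x * y ^+ 2 * x).
Proof.
have [p ->] := bnf_surj x; have [q ->] := bnf_surj y.
rewrite expgS expg1 !bnfM; congr bnf; apply: depth_rise_inj => [h|].
  rewrite !depthM !riseM.
  move: (rise p) (rise q) (p.1) (q.1) => r s m n.
  (* Each letter of the middle factor starts at a height between those of two
     copies of the same letter outside it, hence a consequence of theirs. *)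
  by apply/idP/idP; lia.
by rewrite !riseM; lia.
Qed.
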